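(* Let $G=(V,E)$ be a finite connected undirected unweighted graph with Fiedler eigenvalue $\lambda>0$ and maximum degree $d_{\max}$. Let $s\neq t$ be vertices and let $f^{[s,t]}:=BL^{\dagger}(\chi_s-\chi_t)\in\mathbb{R}^E$ be the unit electric flow from $s$ to $t$. For $0<p\le 1$ let $Q_p:=\{e\in E:\ |f^{[s,t]}_e|\ge p\}$. Then $$|Q_p|\le\min\Big\{\frac{2}{\lambda p^2},\ \frac{2d_{\max}\|L^{\dagger}\|_{1\to1}}{p}\Big\}.$$
   Context: Fix an arbitrary orientation of each edge; $B\in\mathbb{R}^{E\times V}$ has, for an edge $e$ oriented $u\to v$, row $e$ equal to $\chi_u-\chi_v$, where $\chi_x$ is the indicator vector of vertex $x$. $L=B^{T}B$ is the graph Laplacian, $L^{\dagger}$ its Moore–Penrose pseudoinverse, and the Fiedler eigenvalue is the smallest nonzero eigenvalue of $L$. For a matrix $A$, $\|A\|_{1\to1}:=\sup_{x\neq0}\|Ax\|_1/\|x\|_1$. *)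

(* Defs.v *)
From HB Require Import structures.
From mathcomp Require Import all_boot all_order all_algebra.
From mathcomp Require Import classical_sets reals.

Set Implicit Arguments.
Unset Strict Implicit.
Unset Printing Implicit Defensive.

Import Order.TTheory GRing.Theory Num.Theory.
Local Open Scope ring_scope.

(* For a finite type I, R^I is 'cV[R]_#|I|, and the coordinate of a vector at  *)
(* x : I is its entry at enum_rank x : 'I_#|I|.                                *)

Section MatrixNotions.
Variable R : realType.

(* The four Penrose equations. *)
Definition is_pinv m n (A : 'M[R]_(m, n)) (X : 'M[R]_(n, m)) : Prop :=
  [/\ A *m X *m A = A, X *m A *m X = X,
      (A *m X)^T = A *m X & (X *m A)^T = X *m A].

(* The default value 0 is never used: see pinvP. MathComp's pinvmx is not the *)
(* Moore-Penrose inverse in general. *)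
Definition pinv m n (A : 'M[R]_(m, n)) : 'M[R]_(n, m) :=
  xget 0 [set X | is_pinv A X]%classic.

Definition norm1 n (x : 'cV[R]_n) : R := \sum_(i < n) `|x i 0|.

Definition opnorm11 m n (A : 'M[R]_(m, n)) : R :=
  sup [set norm1 (A *m x) / norm1 x | x in [set x : 'cV[R]_n | x != 0]]%classic.

(* MathComp's eigenvalue is about row vectors, which makes no difference for  *)
(* the spectrum of a square matrix. *)
Definition smallest_nonzero_eigenvalue n (A : 'M[R]_n) (a : R) : Prop :=
  [/\ eigenvalue A a, a != 0
    & forall b : R, eigenvalue A b -> b != 0 -> a <= b].

Lemma trmx_mul_eq0 m n (A : 'M[R]_(m, n)) : A *m A^T = 0 -> A = 0.
Proof.
move=> AA0; apply/matrixP => i j; rewrite mxE.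
have /eqP : \sum_k A i k ^+ 2 = 0.
  have /matrixP/(_ i i) := AA0; rewrite !mxE => AA0i; rewrite -[RHS]AA0i.
  by apply: eq_bigr => k _; rewrite mxE expr2.
rewrite psumr_eq0 => [/allP/(_ j)|k _]; last exact: sqr_ge0.
by rewrite mem_index_enum sqrf_eq0 => /(_ isT)/eqP.
Qed.

Lemma gram_unit m n (A : 'M[R]_(m, n)) : row_free A -> A *m A^T \in unitmx.
Proof.
move=> Afree; rewrite -row_free_unit -kermx_eq0.
set K := kermx _; apply/eqP.
have KA : K *m A = 0.
  by apply: trmx_mul_eq0; rewrite trmx_mul -mulmxA (mulmxA A) mulmxA mulmx_ker mul0mx.
by apply: (row_free_inj Afree); rewrite KA mul0mx.
Qed.

Lemma is_pinv_uniq m n (A : 'M[R]_(m, n)) X Y :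
  is_pinv A X -> is_pinv A Y -> X = Y.
Proof.
move=> [X1 X2 X3 X4] [Y1 Y2 Y3 Y4].
have AXY : A *m X = A *m Y.
  by rewrite -X3 -{1}Y1 -(mulmxA (A *m Y)) trmx_mul X3 Y3 mulmxA X1.
have XAY : X *m A = Y *m A.
  by rewrite -X4 -{1}Y1 -mulmxA mulmxA trmx_mul X4 Y4 -mulmxA (mulmxA A) X1.
by rewrite -X2 XAY -mulmxA AXY mulmxA Y2.
Qed.

Lemma is_pinv_exists m n (A : 'M[R]_(m, n)) : exists X, is_pinv A X.
Proof.
have [r [C [F [<- uF uC]]]] : exists r (C : 'M[R]_(m, r)) (F : 'M[R]_(r, n)),
    [/\ C *m F = A, F *m F^T \in unitmx & C^T *m C \in unitmx].
  exists (\rank A), (col_base A), (row_base A); split.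
  - exact: mulmx_base.
  - by apply: gram_unit; exact: row_base_free.
  - rewrite -{2}[col_base A]trmxK; apply: gram_unit.
    by rewrite /row_free mxrank_tr; exact: col_base_full.
pose P := F^T *m invmx (F *m F^T); pose Q := invmx (C^T *m C) *m C^T.
have FP : F *m P = 1%:M by rewrite mulmxA mulmxV.
have QC : Q *m C = 1%:M by rewrite -mulmxA mulVmx.
have AX : C *m F *m (P *m Q) = C *m Q.
  by rewrite -mulmxA (mulmxA F) FP mul1mx.
have XA : (P *m Q) *m (C *m F) = P *m F.
  by rewrite -mulmxA (mulmxA Q) QC mul1mx.
exists (P *m Q); split.
- by rewrite AX mulmxA -(mulmxA C) QC mulmx1.
- by rewrite XA -mulmxA (mulmxA F) FP mul1mx.
- by rewrite AX !trmx_mul trmxK trmx_inv trmx_mul trmxK mulmxA.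
- by rewrite XA !trmx_mul trmxK trmx_inv trmx_mul trmxK mulmxA.
Qed.

Lemma pinvP m n (A : 'M[R]_(m, n)) : is_pinv A (pinv A).
Proof.
by rewrite /pinv; case: xgetP => [//|] none; have [X /none] := is_pinv_exists A.
Qed.

End MatrixNotions.

Section Graphs.
Variables (V : finType) (adj : rel V).

Definition is_edge (e : {set V}) : bool :=
  [exists u, exists v, adj u v && (e == [set u; v])].

Definition edge : predArgType := {e : {set V} | is_edge e}.
HB.instance Definition _ := SubFinite.on edge.

Definition degree (v : V) : nat := #|[set w | adj v w]|.
Definition max_degree : nat := \max_(v : V) degree v.

(* An edge e with o e = (u, v) is oriented u -> v. *)
Definition is_orientation (o : edge -> V * V) : Prop :=
  forall e, val e = [set (o e).1; (o e).2].

Variables (R : realType) (o : edge -> V * V).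

Definition chi (x : V) : 'cV[R]_#|V| := delta_mx (enum_rank x) 0.

Definition incidence : 'M[R]_(#|{: edge}|, #|V|) :=
  \matrix_(i < #|{: edge}|) (chi (o (enum_val i)).1 - chi (o (enum_val i)).2)^T.

Definition laplacian : 'M[R]_#|V| := incidence^T *m incidence.

Definition electric_flow (s t : V) : 'cV[R]_#|{: edge}| :=
  incidence *m pinv laplacian *m (chi s - chi t).

Definition heavy_edges (s t : V) (p : R) : {set edge} :=
  [set e | p <= `|electric_flow s t (enum_rank e) 0|].

End Graphs.

(* Main.v *)
(* Let y = chi_s - chi_t, x = L^+ y and f = B x. Markov's inequality bounds     *)
(* #|Q_p| by |f|_2^2 / p^2 and by |f|_1 / p.                                   *)
(* - Since x lies in the image of L, the spectral theorem gives                *)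
(*   lambda |x|^2 <= x^T L x = |f|_2^2 = x^T y, and then                       *)
(*   0 <= |y - lambda x|^2 <= |y|^2 - lambda x^T y, where |y|^2 = 2.           *)
(* - |f|_1 <= \sum_(uv in E) (|x_u| + |x_v|) = \sum_v deg(v) |x_v|, at most    *)
(*   d_max |x|_1 <= d_max ||L^+||_(1->1) |y|_1, where |y|_1 = 2.               *)

Require Import Defs.
From mathcomp Require Import all_boot all_order all_algebra.
From mathcomp Require boolp.
From mathcomp Require Import classical_sets reals.
From mathcomp Require Import ring lra.
From mathcomp.real_closed Require Import complex.

Import Order.TTheory GRing.Theory Num.Theory.
Local Open Scope ring_scope.

(** Few edges can carry flow at least [p], because both the energy and the total flow of [f] are
    bounded; [markov_heavy_edges] turns each bound into a count. Energy: [f^T f = x^T L x] for the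
    potential [x = L^+ y], and on the image of [L] the quadratic form is at least [lambda] times the
    squared norm ([symmetric_image_rayleigh]), so the energy is at most [|y|^2 / lambda]
    ([pinv_quadratic_le]). Total flow: a vertex potential contributes to at most [d_max] edges
    ([norm1_incidence_mul]), and the operator norm controls the potentials ([norm1_mulmx]). *)

Section Spectral.
Local Open Scope sesquilinear_scope.

(** In a unitary eigenbasis over the complex numbers, the difference of the two sides is a sum of
    [(d_i - a) |u_i|^2]. Taking [x] in the image of [A] kills the coordinates with [d_i = 0]; the
    other [d_i] are at least [a]. *)
Lemma symmetric_image_rayleigh (R : rcfType) n (A : 'M[R]_n) (a : R)
    (z : 'cV[R]_n) (x := A *m z) :
  A^T = A -> (forall b, eigenvalue A b -> b != 0 -> a <= b) ->
  a * (x^T *m x) 0 0 <= (x^T *m A *m x) 0 0.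
Proof.
move=> AT a_le; pose toC := real_complex R.
pose AC := map_mx toC A; pose P := spectralmx AC; pose d := spectral_diag AC.
have toC_real y : toC y \is Num.real by apply/complex_realP; exists y.
have toC0 : toC 0 = 0 := rmorph0 (real_complex R).
have AC_real : AC \is a mxOver Num.real by apply/mxOverP => i j; rewrite mxE.
have AC_sym : AC \is symmetricmx.
  by apply/is_hermitianmxP; rewrite expr0 scale1r map_mx_id // map_trmx AT.
have AC_herm := realsym_hermsym AC_sym AC_real.
have P_unitary : P \is unitarymx := spectral_unitarymx AC.
have P_unit : P \in unitmx := spectral_unit AC.
have PAC : P *m AC = diag_mx d *m P.
  have /orthomx_spectralP E := hermitian_normalmx AC_herm.
  by rewrite {1}E -/P -/d -mulmxA mulKVmx.
have d_real i : exists b, d 0 i = toC b.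
  exact/complex_realP/(mxOverP (hermitian_spectral_diag_real AC_herm)).
have d_ge i b : d 0 i = toC b -> b != 0 -> a <= b.
  move=> db; apply: a_le.
  (* Row [i] of [P] is a complex eigenvector; since [d_i] is real, it is an eigenvalue of the real
     matrix too. *)
  rewrite -(eigenvalue_map (real_complex R)) -[X in eigenvalue _ X]db.
  apply/eigenvalueP; exists (row i P).
    by rewrite -row_mul -/AC PAC row_mul row_diag_mx -scalemxAl -rowE.
  apply/eqP => /(congr1 (mulmx^~ (invmx P))); rewrite mul0mx -row_mul mulmxV //.
  by move/rowP/(_ i); rewrite !mxE eqxx => /eqP; rewrite oner_eq0.
pose u := P *m map_mx toC x.
have uE i : u i 0 = d 0 i * (P *m map_mx toC z) i 0.
  by rewrite /u map_mxM mulmxA PAC -mulmxA mul_diag_mx mxE.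
have PK : P^t* *m P = 1%:M by rewrite -invmx_unitary // mulVmx.
have xT : map_mx toC x^T = u^t* *m P.
  rewrite /u [(P *m _)^T]trmx_mul (map_mxM (@Num.conj _)) -mulmxA PK mulmx1.
  by rewrite map_trmx realmxC //; apply/mxOverP => i j; rewrite mxE.
have xx : toC ((x^T *m x) 0 0) = \sum_i `|u i 0| ^+ 2.
  transitivity ((map_mx toC (x^T *m x)) 0 0); first by rewrite [RHS]mxE.
  rewrite map_mxM xT -mulmxA -/u mxE; apply: eq_bigr => i _.
  by rewrite !mxE normCK mulrC.
have xAx : toC ((x^T *m A *m x) 0 0) = \sum_i d 0 i * `|u i 0| ^+ 2.
  transitivity ((map_mx toC (x^T *m A *m x)) 0 0); first by rewrite [RHS]mxE.
  rewrite !map_mxM xT -/AC -!mulmxA (mulmxA P) PAC -(mulmxA _ P) -map_mxM -/u.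
  rewrite mxE; apply: eq_bigr => i _.
  by rewrite mul_diag_mx !mxE normCK mulrCA [_^* * _]mulrC.
rewrite -subr_ge0 -ler0c rmorphB rmorphM /= -!/(toC _) xx xAx mulr_sumr.
rewrite -sumrB sumr_ge0 // => i _; rewrite -mulrBl.
have [b db] := d_real i; have [b0|b_neq0] := eqVneq b 0.
  by rewrite uE db b0 toC0 mul0r normr0 expr0n mulr0.
rewrite mulr_ge0 ?exprn_ge0 // db -rmorphB ler0c subr_ge0.
exact: d_ge db b_neq0.
Qed.

End Spectral.

Lemma sqr_norm2E (R : comNzRingType) n (x : 'cV[R]_n) :
  (x^T *m x) 0 0 = \sum_i x i 0 ^+ 2.
Proof. by rewrite mxE; apply: eq_bigr => i _; rewrite !mxE. Qed.

Lemma pinv_quadratic_le (R : realType) n (A : 'M[R]_n) (a : R) (y : 'cV[R]_n)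
    (x := pinv A *m y) :
  A^T = A -> 0 < a -> (forall b, eigenvalue A b -> b != 0 -> a <= b) ->
  (x^T *m A *m x) 0 0 <= (y^T *m y) 0 0 / a.
Proof.
move=> AT a_gt0 a_le; have [AXA XAX AX_sym XA_sym] := pinvP A.
(* By symmetry [A^+ A = A (A^+)^T], which puts [x] in the image of [A]. *)
have xE : x = A *m ((pinv A)^T *m x).
  by rewrite mulmxA -{1}AT -trmx_mul XA_sym /x mulmxA XAX.
have xAx : x^T *m A *m x = x^T *m y.
  have xAX : x^T *m (A *m pinv A) = x^T.
    by rewrite -AX_sym -trmx_mul {1}xE (mulmxA (_ *m _)) AXA -xE.
  by rewrite -[in RHS]xAX /x -!mulmxA.
have := symmetric_image_rayleigh R n A a ((pinv A)^T *m x) AT a_le.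
rewrite -xE xAx.
(* Expanding this square and using [a^2 |x|^2 <= a x^T y] gives [a x^T y <= |y|^2]. *)
have : 0 <= ((y - a *: x)^T *m (y - a *: x)) 0 0.
  by rewrite sqr_norm2E sumr_ge0 // => i _; exact: sqr_ge0.
have -> : ((y - a *: x)^T *m (y - a *: x)) 0 0 =
    (y^T *m y) 0 0 - 2 * a * (x^T *m y) 0 0 + a ^+ 2 * (x^T *m x) 0 0.
  rewrite !mxE !mulr_sumr -sumrB -big_split /=.
  by apply: eq_bigr => i _; rewrite !mxE; ring.
rewrite ler_pdivlMr // => yax_ge0 xx_le; nra.
Qed.

Section Norm1.
Variable R : realType.

Lemma norm1_ge0 n (x : 'cV[R]_n) : 0 <= norm1 x.
Proof. exact: sumr_ge0. Qed.

Lemma norm1_eq0 n (x : 'cV[R]_n) : (norm1 x == 0) = (x == 0).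
Proof.
apply/idP/eqP => [|->]; last by rewrite /norm1 big1 // => i _; rewrite mxE normr0.
rewrite psumr_eq0 // => /allP x0; apply/colP => i; rewrite mxE.
by apply/eqP; rewrite -normr_eq0; exact: x0 (mem_index_enum i).
Qed.

Lemma norm1_mulmx m n (A : 'M[R]_(m, n)) (x : 'cV_n) :
  norm1 (A *m x) <= opnorm11 A * norm1 x.
Proof.
have [->|x_neq0] := eqVneq x 0.
  have n0 k : norm1 (0 : 'cV[R]_k) = 0 by apply/eqP; rewrite norm1_eq0.
  by rewrite mulmx0 !n0 mulr0.
have norm1_gt0 y : y != 0 -> 0 < @norm1 R n y.
  by move=> y_neq0; rewrite lt_def norm1_eq0 y_neq0 norm1_ge0.
rewrite -ler_pdivrMr ?norm1_gt0 //; apply: ub_le_sup; last by exists x.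
(* The supremum only needs some finite upper bound; the sum of all entries is a crude one. *)
exists (\sum_i \sum_j `|A i j|) => _ [y y_neq0 <-].
rewrite ler_pdivrMr ?norm1_gt0 // mulr_suml ler_sum // => i _.
rewrite mxE mulr_suml (le_trans (ler_norm_sum _ _ _)) // ler_sum // => j _.
by rewrite normrM ler_wpM2l // /norm1 (bigD1 j) //= lerDl sumr_ge0.
Qed.

Lemma opnorm11_ge0 m n (A : 'M[R]_(m, n)) : 0 <= opnorm11 A.
Proof.
rewrite /opnorm11; set E := image _ _.
(* Without nonzero vectors the set is empty and [sup] takes its default value 0. *)
have [supE|/sup_out -> //] := boolp.pselect (has_sup E).
have [r Er] := supE.1; apply: le_trans (sup_upper_bound supE Er).
by case: Er => x _ <-; rewrite divr_ge0 ?norm1_ge0.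
Qed.

Lemma norm1_chiB (V : finType) (s t : V) : norm1 (chi R s - chi R t) <= 2.
Proof.
have norm1_chi (v : V) : \sum_i `|chi R v i 0| = 1.
  rewrite (bigD1 (enum_rank v)) //= mxE !eqxx normr1 big1 ?addr0 // => i.
  by move=> /negPf neq; rewrite mxE neq normr0.
rewrite -[leRHS]/(1 + 1) -{1}(norm1_chi s) -(norm1_chi t) -big_split /=.
by apply: ler_sum => i _; rewrite !mxE ler_normB.
Qed.

End Norm1.

Section ElectricFlow.
Variables (R : realType) (V : finType) (adj : rel V).
Hypotheses (adj_sym : symmetric adj) (adj_irr : irreflexive adj).
Variable o : edge adj -> V * V.
Hypothesis o_orient : is_orientation o.

Local Notation B := (incidence R o).

Lemma edge_endpoints_neq (e : edge adj) : (o e).1 != (o e).2.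
Proof.
have /existsP[u /existsP[v /andP[uv /eqP]]] := valP e.
rewrite o_orient => E; apply/eqP => oo.
have /(congr1 (fun A : {set V} => #|A|)) := E.
rewrite oo finset.setUid cards1 cards2; case: eqVneq uv => // ->.
by rewrite adj_irr.
Qed.

(** Every edge at [v] has the form [{v, w}] for a neighbour [w], so neighbours map onto incident
    edges. *)
Lemma card_incident_edges (v : V) :
  (#|[set e : edge adj | v \in val e]| <= max_degree adj)%N.
Proof.
apply: leq_trans (leq_bigmax v).
rewrite -(card_imset _ val_inj).
rewrite (leq_trans _ (leq_imset_card (fun w => [set v; w]) _)) //.
apply/subset_leq_card/fintype.subsetP => _ /imsetP[e + ->]; rewrite inE.
have /existsP[u /existsP[w /andP[uw /eqP ->]]] := valP e.
rewrite !inE => /orP[] /eqP ->; apply/imsetP.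
  by exists w; rewrite ?inE.
by exists u; rewrite ?inE 1?adj_sym // finset.setUC.
Qed.

Lemma incidence_mulE (x : 'cV[R]_#|V|) (e : edge adj) :
  (B *m x) (enum_rank e) 0 =
    x (enum_rank (o e).1) 0 - x (enum_rank (o e).2) 0.
Proof.
have chiE v : ((chi R v)^T *m x) 0 0 = x (enum_rank v) 0.
  by rewrite trmx_delta -rowE mxE.
transitivity (((chi R (o e).1 - chi R (o e).2)^T *m x) 0 0).
  by rewrite !mxE; apply: eq_bigr => j _; rewrite !mxE enum_rankK.
by rewrite linearB mulmxBl mxE [X in _ + X]mxE !chiE.
Qed.

Lemma norm1_incidence_mul (x : 'cV[R]_#|V|) :
  norm1 (B *m x) <= (max_degree adj)%:R * norm1 x.
Proof.
pose a v : R := `|x (enum_rank v) 0|.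
have -> : norm1 (B *m x) = \sum_(e : edge adj) `|(B *m x) (enum_rank e) 0|.
  by rewrite /norm1 (reindex _ (onW_bij _ (enum_rank_bij (edge adj)))).
have -> : norm1 x = \sum_v a v.
  by rewrite /norm1 (reindex _ (onW_bij _ (enum_rank_bij V))).
apply: (@le_trans _ _ (\sum_(e : edge adj) \sum_(v in val e) a v)).
  apply: ler_sum => e _; rewrite incidence_mulE o_orient.
  by rewrite big_setU1 ?inE ?edge_endpoints_neq //= big_set1 ler_normB.
rewrite (exchange_big_dep predT) //= mulr_sumr ler_sum // => v _.
rewrite sumr_const -[leLHS]mulr_natl ler_wpM2r ?normr_ge0 // ler_nat.
by rewrite (leq_trans _ (card_incident_edges v)) // cardsE.
Qed.

(** Markov's inequality for a general power: [k = 2] serves the energy bound and [k = 1] the total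
    flow bound. *)
Lemma markov_heavy_edges (s t : V) (p : R) (k : nat) : 0 < p ->
  p ^+ k * #|heavy_edges o s t p|%:R <=
    \sum_i `|electric_flow R o s t i 0| ^+ k.
Proof.
move=> p_gt0; rewrite (reindex _ (onW_bij _ (enum_rank_bij (edge adj)))) /=.
rewrite mulr_natr -sumr_const.
rewrite [leRHS](bigID (mem (heavy_edges o s t p))) /= -[leLHS]addr0.
apply: lerD; last by apply: sumr_ge0 => e _; exact: exprn_ge0.
by apply: ler_sum => e; rewrite inE => pe; rewrite lerXn2r ?nnegrE // ltW.
Qed.

End ElectricFlow.

Theorem theorem4 (R : realType) (V : finType) (adj : rel V)
    (adj_sym : symmetric adj) (adj_irr : irreflexive adj)
    (adj_connected : forall u v : V, connect adj u v)
    (o : edge adj -> V * V) (o_orient : is_orientation o)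
    (lambda : R)
    (lambda_fiedler : smallest_nonzero_eigenvalue (laplacian R o) lambda)
    (lambda_gt0 : 0 < lambda)
    (s t : V) (s_neq_t : s != t)
    (p : R) (p_gt0 : 0 < p) (p_le1 : p <= 1) :
  #|heavy_edges o s t p|%:R <=
    Num.min (2 / (lambda * p ^+ 2))
      (2 * (max_degree adj)%:R * opnorm11 (pinv (laplacian R o)) / p).
Proof.
have flowE : electric_flow R o s t =
    incidence R o *m (pinv (laplacian R o) *m (chi R s - chi R t)).
  by rewrite mulmxA.
rewrite le_min; apply/andP; split.
  have [_ _ lambda_le] := lambda_fiedler.
  have L_sym : (laplacian R o)^T = laplacian R o by rewrite trmx_mul trmxK.
  rewrite invfM mulrA ler_pdivlMr ?exprn_gt0 // [leLHS]mulrC.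
  apply: le_trans (markov_heavy_edges R V adj o s t p 2 p_gt0) _.
  have -> : \sum_i `|electric_flow R o s t i 0| ^+ 2 =
      ((electric_flow R o s t)^T *m electric_flow R o s t) 0 0.
    by rewrite sqr_norm2E; apply: eq_bigr => i _; rewrite real_normK ?num_real.
  rewrite {1}flowE trmx_mul flowE mulmxA -(mulmxA _ _^T).
  apply: le_trans (pinv_quadratic_le R _ _ _ _ L_sym lambda_gt0 lambda_le) _.
  rewrite ler_wpM2r ?invr_ge0 ?(ltW lambda_gt0) //.
  (* The entries of [y] lie in [[-1, 1]], so their squares are at most their absolute values and
     [|y|_2^2 <= |y|_1 <= 2]. *)
  rewrite (le_trans _ (norm1_chiB R V s t)) // sqr_norm2E ler_sum // => i _.
  rewrite -real_normK ?num_real // expr2 ler_piMr // !mxE.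
  by do 2!case: (_ && _) => /=; rewrite ler_norml; lra.
rewrite ler_pdivlMr // [leLHS]mulrC.
have := markov_heavy_edges R V adj o s t p 1 p_gt0.
rewrite expr1 => /le_trans; apply.
under eq_bigr do rewrite expr1.
rewrite -/(norm1 _) flowE.
apply: le_trans (norm1_incidence_mul R V adj adj_sym adj_irr o o_orient _) _.
rewrite [2 * _]mulrC -!mulrA ler_wpM2l // mulrC.
apply: le_trans (norm1_mulmx R _ _ _ _) _; rewrite ler_wpM2l ?norm1_chiB //.
exact: opnorm11_ge0.
Qed.
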